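(* Let $\kappa<2^{\aleph_0}$ be a cardinal and assume that Martin's axiom $\mathrm{MA}(\kappa)$ holds. Then there are no infinite $\kappa$-Souslin maximal almost disjoint families of subsets of $\omega$.
   Context: $\omega=\{0,1,2,\ldots\}$, and $\mathcal P(\omega)$ is identified with $2^\omega$ via characteristic functions. An almost disjoint family is a family $\mathcal A\subseteq\mathcal P(\omega)$ of infinite subsets of $\omega$ such that for all $x,y\in\mathcal A$, either $x=y$ or $x\cap y$ is finite. It is maximal (a ''mad family'') if no strictly larger almost disjoint family contains it. A set $\mathcal A\subseteq 2^\omega$ is $\kappa$-Souslin if there is a tree $T$ on $2\times\kappa$ such that $\mathcal A=p[T]=\{x\in 2^\omega:(\exists y\in\kappa^\omega)\ (x,y)\in[T]\}$, where $[T]$ is the set of infinite branches of $T$. $\mathrm{MA}(\kappa)$ is the statement: for every nonempty ccc poset $\mathbb P$ and every family $\mathcal D$ of at most $\kappa$ dense subsets of $\mathbb P$ there is a filter on $\mathbb P$ meeting every member of $\mathcal D$. *)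

(* Defs.v *)
From HB Require Import structures.
From mathcomp Require Import all_boot all_order.
From mathcomp Require Import all_classical.

Set Implicit Arguments.
Unset Strict Implicit.
Unset Printing Implicit Defensive.

Local Open Scope classical_set_scope.
Local Open Scope card_scope.

Definition almost_disjoint_family (A : set (set nat)) : Prop :=
  (forall x, A x -> infinite_set x) /\
  (forall x y, A x -> A y -> x = y \/ finite_set (x `&` y)).

Definition mad_family (A : set (set nat)) : Prop :=
  almost_disjoint_family A /\
  ~ (exists B, almost_disjoint_family B /\ A `<` B).

(* A cardinal is represented by an arbitrary type [K] of that cardinality.
   A node of a tree on [2 x K] is a finite sequence of pairs, rather than a
   pair of finite sequences of the same length. *)

Definition is_tree (X : Type) (T : set (seq X)) : Prop :=
  forall s t, T (s ++ t) -> T s.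

Definition branches (X : Type) (T : set (seq X)) : set (nat -> X) :=
  [set z | forall n, T (mkseq z n)].

Definition tree_projection (K : Type) (T : set (seq (bool * K))) :
    set (nat -> bool) :=
  [set x | exists y : nat -> K, branches T (fun n => (x n, y n))].

Definition char_fun (x : set nat) : nat -> bool := fun n => n \in x.

Definition Souslin (K : Type) (A : set (set nat)) : Prop :=
  exists T : set (seq (bool * K)),
    is_tree T /\ char_fun @` A = tree_projection T.

(* Forcing convention: [q <= p] means that [q] is stronger than [p]. *)

Section Posets.
Context {d : Order.disp_t} {P : porderType d}.
Implicit Types (p q r : P) (A D F : set P).

Definition compatible p q : Prop := exists r, (r <= p)%O /\ (r <= q)%O.

Definition antichain A : Prop :=
  forall p q, A p -> A q -> p <> q -> ~ compatible p q.

Definition dense_subset D : Prop := forall p, exists q, D q /\ (q <= p)%O.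

Definition poset_filter F : Prop :=
  [/\ F !=set0,
      forall p q, F p -> (p <= q)%O -> F q &
      forall p q, F p -> F q -> exists r, [/\ F r, (r <= p)%O & (r <= q)%O]].

End Posets.

Definition ccc (d : Order.disp_t) (P : porderType d) : Prop :=
  forall A : set P, antichain A -> countable A.

Definition MA (K : Type) : Prop :=
  forall (d : Order.disp_t) (P : porderType d),
    [set: P] !=set0 -> ccc P ->
    forall DD : set (set P),
      DD #<= [set: K] -> (forall D, DD D -> dense_subset D) ->
      exists F : set P,
        poset_filter F /\ (forall D, DD D -> F `&` D !=set0).

Definition card_lt (T U : Type) : Prop :=
  [set: T] #<= [set: U] /\ ~ ([set: U] #<= [set: T]).

(* Main.v *)
From HB Require Import structures.
Require Import Defs.
From mathcomp Require Import all_boot all_order.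
From mathcomp Require Import all_classical finmap.

(** Replacing a finite [K] by [nat], for which Martin's axiom is the
    Rasiowa-Sikorski lemma, the cardinal [kappa] of [K] may be taken to be infinite.

    Let [A] be an infinite mad family which is the projection of a tree [T]
    with at most [kappa] nodes. A set [X] of natural numbers is positive if it
    has an infinite intersection with infinitely many members of [A]. Martin's
    axiom for the [sigma]-centered forcing adding a pseudo-intersection,
    together with maximality, shows that a family of at most [kappa] sets
    whose finite intersections are positive has a positive pseudo-intersection
    ([positive_pseudo_intersection]).

    For a subtree [S] of [T] the shadow of a node is the union of the sets
    coded by the branches of [S] through it. The kernel of [X] is the largest
    subtree all of whose shadows have a positive intersection with [X]. It
    decreases when [X] shrinks, and since there are at most [kappa] nodes to
    lose, there is a positive [X] for which the kernel is the same for all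
    positive subsets of [X] ([stable_kernel]). Let [S] be this kernel.

    If [S] is nonempty, then [X] minus the shadow of a node of [S] is never
    positive, as shrinking [X] to this difference would remove the node. Hence
    any two nodes of [S] have shadows with an infinite intersection, and two
    branches of [S] coding distinct sets with infinite intersection can be
    built side by side ([infinite_common_part]), so [A] is not almost
    disjoint.

    If [S] is empty, then at most [kappa] members of [A] have an infinite
    intersection with [X]: otherwise the nodes of [T] through which there are
    more than [kappa] of them form a nonempty subtree [S'], some node of [S']
    has a shadow in [S'] with a non-positive intersection with [X], and those
    of the members that are coded by branches through this node consist of
    finitely many coming from branches of [S'] and of at most [kappa] coming
    from each of the nodes outside of [S']. So the family of all [X `\` a],
    with [a] in [A] meeting [X] in an infinite set, has a positive
    pseudo-intersection, which is absurd. *)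

Set Implicit Arguments.
Unset Strict Implicit.
Unset Printing Implicit Defensive.

Local Open Scope classical_set_scope.
Local Open Scope card_scope.

(** * Cardinal arithmetic *)

Lemma card_le_injP (T K : Type) (k0 : K) (A : set T) :
  A #<= [set: K] <->
  exists f : T -> K, forall x y, A x -> A y -> f x = f y -> x = y.
Proof.
elim/Ppointed: K => K in k0 *; first by case: (no k0).
split=> [/pcard_injP[f finj]|[f finj]].
  by exists f => x y Ax Ay; apply: finj; apply: mem_set.
by apply/pcard_injP; exists f => x y /set_mem Ax /set_mem; exact: finj.
Qed.

(** Any two sets have comparable cardinalities: a maximal partial injection
    exhausts one of them. *)
Lemma card_le_total (T U : Type) (A : set T) (B : set U) (t0 : T) (u0 : U) :
  (exists f : T -> U, (forall x, A x -> B (f x)) /\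
     forall x y, A x -> A y -> f x = f y -> x = y) \/
  (exists g : U -> T, (forall x, B x -> A (g x)) /\
     forall x y, B x -> B y -> g x = g y -> x = y).
Proof.
pose P (G : set (T * U)) :=
  (forall p, G p -> A p.1 /\ B p.2) /\
  (forall p q, G p -> G q -> p.1 = q.1 <-> p.2 = q.2).
have [F FP totF|G [[GAB Ginj] Gmax]] := @Zorn_bigcup _ P.
  split=> [p [G FG Gp]|p q [G FG Gp] [H FH Hq]]; first exact: (FP _ FG).1.
  case: (totF _ _ FG FH) => sub.
    by apply: (FP _ FH).2 => //; exact: sub.
  by apply: (FP _ FG).2 => //; exact: sub.
have [allA|] := pselect (forall x, A x -> exists y, G (x, y)).
  left; have /choice[f fG] : forall x, exists y, A x -> G (x, y).
    move=> x; have [/allA[y Gxy]|] := pselect (A x); first by exists y.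
    by exists u0.
  exists f; split=> [x /fG/GAB[]//|x y /fG Gx /fG Gy].
  exact: (Ginj _ _ Gx Gy).2.
move=> /existsNP[x /not_implyP[Ax /forallNP xG]].
right; have allB y : B y -> exists x, G (x, y).
  move=> By; apply: contrapT => /forallNP yG.
  apply: (Gmax (G `|` [set (x, y)])).
    split=> [p Gp|/(_ (x, y))]; first by left.
    by move=> /(_ (or_intror erefl)); exact: xG.
  split=> [p [/GAB//|->//]|p q [Gp|->] [Gq|->]] //=; first exact: Ginj.
    by case: p Gp => p1 p2 /= Gp; split=> e; move: Gp; rewrite e;
      [move/xG|move/yG].
  by case: q Gq => p1 p2 /= Gp; split=> e; move: Gp; rewrite -e;
    [move/xG|move/yG].
have /choice[g gG] : forall y, exists x, B y -> G (x, y).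
  move=> y; have [/allB[z Gzy]|] := pselect (B y); first by exists z.
  by exists t0.
exists g; split=> [y /gG/GAB[]//|y z /gG Gy /gG Gz].
exact: (Ginj _ _ Gy Gz).1.
Qed.

(** Hessenberg's theorem [kappa * kappa = kappa] for infinite cardinals, in
    the form of an injective pairing function.  By Zorn's lemma there is a
    maximal set [D], containing a fixed countably infinite set, with an
    injection [f] of [D * D] into [D].  If [D] had a disjoint copy, then [f]
    could be extended to the union of [D] and this copy; hence [~` D] embeds
    in [D], and then so does the whole type. *)
Lemma infinite_pairing (K : Type) : infinite_set [set: K] ->
  exists h : K -> K -> K,
    forall x y x' y', h x y = h x' y' -> x = x' /\ y = y'.
Proof.
move=> Kinf.
have [k0 _] := infinite_setN0 Kinf.
have [i iinj] : exists i : nat -> K, injective i.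
  move/infiniteP/(card_le_injP k0): Kinf => [i iinj].
  by exists i => m n; exact: iinj.
(* Partial pairing functions are represented by their graphs, whose domain is
   recovered from the diagonal; [Q G] says that [G] is the graph of an
   injection of [dom G * dom G] into [dom G].  Zorn's lemma is applied to the
   graphs extending [G0], that is, to all [G] such that [Q (G0 `|` G)]. *)
pose G0 : set (K * K * K) :=
  [set (i m, i n, i (choice.pickle (m, n))) | m in setT & n in setT].
pose dom (G : set (K * K * K)) x := exists z, G (x, x, z).
pose Q (G : set (K * K * K)) := [/\
  forall p q, G p -> G q -> p.1 = q.1 <-> p.2 = q.2,
  forall x y, dom G x -> dom G y -> exists z, G (x, y, z) &
  forall p, G p -> [/\ dom G p.1.1, dom G p.1.2 & dom G p.2]].
have QG0 : Q G0.
  have dG0 m : dom G0 (i m).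
    by exists (i (choice.pickle (m, m))); exists m => //; exists m.
  have dG0P x : dom G0 x -> exists m, x = i m.
    by move=> [z [m _ [n _ [<-]]]]; exists m.
  split.
  - move=> _ _ [m _ [n _ <-]] [m' _ [n' _ <-]] /=; split.
      by move=> [/iinj-> /iinj->].
    by move=> /iinj/(pcan_inj choice.pickleK)[-> ->].
  - move=> x y /dG0P[m ->] /dG0P[n ->]; exists (i (choice.pickle (m, n))).
    by exists m => //; exists n.
  - by move=> _ [m _ [n _ <-]] /=; split; exact: dG0.
have [F FP totF|A [QA Amax]] := @Zorn_bigcup _ [set G | Q (G0 `|` G)].
  have [[G1 FG1]|F0] := pselect (F !=set0); last first.
    suff -> : \bigcup_(X in F) X = set0 by rewrite /= setU0.
    by rewrite -subset0 => x [G FG]; case: F0; exists G.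
  have union p : (G0 `|` \bigcup_(X in F) X) p <->
      exists2 G, F G & (G0 `|` G) p.
    split=> [[Gp|[G FG Gp]]|[G FG [Gp|Gp]]].
    - by exists G1 => //; left.
    - by exists G => //; right.
    - by left.
    - by right; exists G.
  have common p q : (G0 `|` \bigcup_(X in F) X) p ->
     (G0 `|` \bigcup_(X in F) X) q ->
     exists G, [/\ F G, (G0 `|` G) p & (G0 `|` G) q].
    move=> /union[G FG Gp] /union[H FH Hq].
    case: (totF _ _ FG FH) => [GH|HG]; [exists H|exists G]; split=> //.
      exact: (setUS GH).
    exact: (setUS HG).
  have domU G x : F G -> dom (G0 `|` G) x -> dom (G0 `|` \bigcup_(X in F) X) x.
    by move=> FG [z Gz]; exists z; apply/union; exists G.
  split.
  - move=> p q /common/[apply] -[G [FG Gp Gq]].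
    by have [+ _ _] := FP _ FG; apply.
  - move=> x y [zx /common Gx] [zy /Gx[G [FG Gpx Gpy]]].
    have [_ /(_ x y) + _] := FP _ FG.
    case; [by exists zx|by exists zy|move=> z Gz; exists z].
    by apply/union; exists G.
  - move=> p /union[G FG Gp]; have [_ _ /(_ p Gp)[]] := FP _ FG.
    by move=> *; split; apply: domU FG _.
have {Amax} Gmax G : Q G -> G0 `|` A `<=` G -> G `<=` G0 `|` A.
  move=> QG sub p Gp; apply: contrapT => Ap; apply: (Amax G).
    split=> [q Aq|GA]; first by apply: sub; right.
    by apply: Ap; right; exact: GA.
  rewrite /= (_ : _ `|` G = G)//; apply/setUidPr => q G0q; apply: sub; by left.
move: QA (@subsetUl _ G0 A) Gmax; rewrite /=.
move: (G0 `|` A) => G [Ginj Gtot Gdom] G0G Gmax.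
set D := dom G in Gtot Gdom.
have Di n : D (i n).
  by exists (i (choice.pickle (n, n))); apply: G0G; exists n => //; exists n.
have [f fG] : exists f : K -> K -> K, forall x y, D x -> D y -> G (x, y, f x y).
  have /choice[f fG] : forall p : K * K, exists z, D p.1 -> D p.2 -> G (p, z).
    move=> [x y]; have [Dx|] := pselect (D x); last by exists k0.
    have [Dy|] := pselect (D y); last by exists k0.
    by have [z Gz] := Gtot _ _ Dx Dy; exists z.
  by exists (fun x y => f (x, y)) => x y; exact: fG (x, y).
have fD x y : D x -> D y -> D (f x y).
  by move=> Dx Dy; have [] := Gdom _ (fG _ _ Dx Dy).
have finj x y x' y' : D x -> D y -> D x' -> D y' ->
    f x y = f x' y' -> x = x' /\ y = y'.
  move=> Dx Dy Dx' Dy' fxy.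
  by have [_ /(_ fxy)[]] := Ginj _ _ (fG _ _ Dx Dy) (fG _ _ Dx' Dy').
have inji m n : i m = i n -> m = n by move/iinj.
have [|[g [gD ginj]]] := card_le_total (~` D) D k0 k0.
  move=> [g [gD ginj]].
  (* [e] embeds the whole type in [D]. *)
  pose e x := if pselect (D x) then f (i 0%N) x else f (i 1%N) (g x).
  have eD x : D (e x).
    by rewrite /e; case: pselect => Dx; apply: fD => //; exact: gD.
  have einj x y : e x = e y -> x = y.
    rewrite /e; case: pselect => Dx; case: pselect => Dy.
    - by move/finj; case.
    - by move/finj; case=> //; [exact: gD|move/inji].
    - by move/finj; case=> //; [exact: gD|move/inji].
    - by move/finj; case=> //; [exact: gD|exact: gD|move=> _; exact: ginj].
  exists (fun x y => f (e x) (e y)) => x y x' y' /finj[]//.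
  by move=> /einj-> /einj->.
(* Otherwise [g] maps [D] onto a disjoint copy of it; [f] is extended to
   [E * E], where [E] is the union of [D] and the copy, by means of the
   retraction [r] of [E] onto [D].  The new values lie in the copy, and [flag]
   records which of the arguments is in [D]. *)
exfalso.
pose E := D `|` (g @` D).
have [r rD rg] : exists2 r : K -> K, forall x, D x -> r x = x &
    forall x, D x -> r (g x) = x.
  have /choice[r rP] : forall x, exists y,
      (D x -> y = x) /\ (forall z, D z -> x = g z -> y = z).
    move=> x; have [Dx|nDx] := pselect (D x).
      exists x; split=> // z Dz xz; by have := gD _ Dz; rewrite -xz.
    have [[z [Dz xz]]|nz] := pselect (exists z, D z /\ x = g z).
      by exists z; split=> // w Dw; rewrite xz; exact: ginj.
    by exists x; split=> // w Dw xw; case: nz; exists w.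
  exists r => x Dx; first exact: (rP x).1 Dx.
  exact: (rP (g x)).2 Dx erefl.
have rED x : E x -> D (r x).
  by case=> [Dx|[y Dy <-]]; rewrite ?rg ?rD.
have rinj x y : E x -> E y -> (D x <-> D y) -> r x = r y -> x = y.
  case=> [Dx|[x' Dx' <-]] [Dy|[y' Dy' <-]]; rewrite ?rg ?rD //;
    last by move=> _ ->.
    by case=> /(_ Dx)/(gD _ Dy').
  by case=> _ /(_ Dy)/(gD _ Dx').
pose flag x y :=
  if pselect (D x) then 0%N else if pselect (D y) then 1%N else 2%N.
pose new x y := g (f (i (flag x y)) (f (r x) (r y))).
pose N : set (K * K * K) :=
  [set p | [/\ E p.1.1, E p.1.2, ~ (D p.1.1 /\ D p.1.2) &
                p.2 = new p.1.1 p.1.2]].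
have newE x y : E x -> E y -> (g @` D) (new x y).
  move=> /rED rx /rED ry; exists (f (i (flag x y)) (f (r x) (r y))) => //.
  exact: fD _ _ (Di _) (fD _ _ rx ry).
have newinj x y x' y' : E x -> E y -> E x' -> E y' ->
    ~ (D x /\ D y) -> ~ (D x' /\ D y') ->
    new x y = new x' y' -> x = x' /\ y = y'.
  move=> Ex Ey Ex' Ey' nD nD'.
  have [rx ry rx' ry'] : [/\ D (r x), D (r y), D (r x') & D (r y')].
    by split; exact: rED.
  have fDD u v w z : D u -> D v -> D (f (i (flag w z)) (f u v)).
    by move=> Du Dv; exact: fD _ _ (Di _) (fD _ _ Du Dv).
  move=> /(ginj _ _ (fDD _ _ _ _ rx ry) (fDD _ _ _ _ rx' ry')).
  move=> /(finj _ _ _ _ (Di _) (fD _ _ rx ry) (Di _) (fD _ _ rx' ry'))[].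
  move/inji => flagE /finj[]// rxx' ryy'.
  have [DD DD'] : (D x <-> D x') /\ (D y <-> D y').
    by move: flagE; rewrite /flag; do 4!case: pselect => //; tauto.
  by split; exact: rinj.
have domGN x : dom (G `|` N) x <-> E x.
  split=> [[z [Gz|[//]]]|].
    by left; exists z.
  have [Dx _|nDx Ex] := pselect (D x).
    by have [z Gz] := Dx; exists z; left.
  by exists (new x x); right; split=> //= -[].
have GD x y z : G (x, y, z) -> [/\ D x, D y & D z] by move/Gdom.
have : N `<=` G.
  suff QGN : Q (G `|` N).
    by move=> p Np; apply: (Gmax _ QGN); [exact: subsetUl|right].
  split.
  - move=> [[x y] z] [[x' y'] z'] /= [Gp|[/= Ep1 Ep2 nDp ->]]
        [Gq|[/= Eq1 Eq2 nDq ->]].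
    + exact: (Ginj _ _ Gp Gq).
    + have [Dx Dy Dz] := GD _ _ _ Gp.
      split=> [[? ?]|zz']; first by subst; case: nDq.
      have [w Dw wE] := newE _ _ Eq1 Eq2.
      by have := gD _ Dw; rewrite wE -zz'.
    + have [Dx Dy Dz] := GD _ _ _ Gq.
      split=> [[? ?]|zz']; first by subst; case: nDp.
      have [w Dw wE] := newE _ _ Ep1 Ep2.
      by have := gD _ Dw; rewrite wE zz'.
    + split=> [[-> ->]//|/newinj[]// -> ->//].
  - move=> x y /domGN Ex /domGN Ey.
    have [[Dx Dy]|nD] := pselect (D x /\ D y).
      by have [z Gz] := Gtot _ _ Dx Dy; exists z; left.
    by exists (new x y); right.
  - move=> [[x y] z] /= [/GD[Dx Dy Dz]|[/= Ex Ey _ ->]].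
      by split; apply/domGN; left.
    by split; apply/domGN => //; right; exact: newE.
pose x := g (i 0%N); have Ex : E x by right; exists (i 0%N).
have nDx : ~ D x by exact: gD.
move/(_ (x, x, new x x)); case/(_ _)/Gdom; last by [].
by split=> //= -[].
Qed.

Section InfiniteCardinal.
Context (K : Type) (Kinf : infinite_set [set: K]).

Lemma countable_card_le (T : Type) (A : set T) :
  countable A -> A #<= [set: K].
Proof. by move=> Ac; apply: card_le_trans Ac _; apply/infiniteP. Qed.

Lemma card_le_bigcup (I T : Type) (A : set I) (B : I -> set T) :
  A #<= [set: K] -> (forall i, A i -> B i #<= [set: K]) ->
  \bigcup_(i in A) B i #<= [set: K].
Proof.
have [k0 _] := infinite_setN0 Kinf.
move=> /(card_le_injP k0)[e einj] BK.
have [h hinj] := infinite_pairing Kinf.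
have /choice[f finj] : forall i, exists f : T -> K,
    A i -> forall x y, B i x -> B i y -> f x = f y -> x = y.
  move=> i; have [Ai|] := pselect (A i); last by exists (fun=> k0).
  by move/(card_le_injP k0): (BK i Ai) => [f finj]; exists f.
have /choice[g gP] : forall x, exists k, (\bigcup_(i in A) B i) x ->
    exists i, [/\ A i, B i x & k = h (e i) (f i x)].
  move=> x; have [[i Ai Bx]|] := pselect ((\bigcup_(i in A) B i) x).
    by exists (h (e i) (f i x)) => _; exists i.
  by exists k0.
apply/(card_le_injP k0); exists g => x y /gP[i [Ai Bx ->]] /gP[j [Aj By ->]].
move=> /hinj[/(einj _ _ Ai Aj) ij]; rewrite -{}ij in By *.
exact: finj.
Qed.

Lemma card_leU (T : Type) (A B : set T) :
  A #<= [set: K] -> B #<= [set: K] -> A `|` B #<= [set: K].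
Proof.
move=> AK BK; rewrite -bigcup2E; apply: card_le_bigcup.
  exact: countable_card_le.
by move=> [|[|n]] _ //=; exact: card_ge0.
Qed.

Lemma card_le_seq (T : Type) : [set: T] #<= [set: K] ->
  [set: seq T] #<= [set: K].
Proof.
have [k0 _] := infinite_setN0 Kinf.
have [h hinj] := infinite_pairing Kinf.
have [j jinj] : exists j : nat -> K, injective j.
  move/infiniteP/(card_le_injP k0): Kinf => [j jinj].
  by exists j => m n; exact: jinj.
move=> /(card_le_injP k0)[e einj].
pose c := fix c s :=
  if s is x :: s' then h (j 1%N) (h (e x) (c s')) else h (j 0%N) k0.
apply/(card_le_injP k0); exists c => s t _ _.
elim: s t => [|x s IH] [|y t] //=; try by move=> /hinj[/jinj].
by move=> /hinj[_ /hinj[/einj-> // /IH->]].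
Qed.

End InfiniteCardinal.

Lemma card_le_seq_pair (K K' : Type) : infinite_set [set: K'] ->
  [set: K] #<= [set: K'] -> [set: seq (bool * K)] #<= [set: K'].
Proof.
move=> K'inf KK'; apply: (card_le_seq K'inf).
rewrite (_ : [set: bool * K] = \bigcup_(b in [set: bool]) range (pair b)).
  apply: (card_le_bigcup K'inf) => [|b _]; first exact: countable_card_le.
  exact: card_le_trans (card_image_le _ _) KK'.
by rewrite predeqE => -[b k]; split=> // _; exists b => //; exists k.
Qed.

(** * Pseudo-intersections from Martin's axiom *)

(** The Rasiowa-Sikorski lemma, which holds for all posets. *)
Lemma MA_nat : MA nat.
Proof.
move=> d P [p0 _] _ DD DDc DDdense.
have [e eDD] : exists e : nat -> set P,
    (forall n, dense_subset (e n)) /\ DD `<=` range e.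
  have [[D0 DD0]|DD0] := pselect (DD !=set0); last first.
    exists (fun=> setT); split=> [_ p|D DDD]; first by exists p.
    by case: DD0; exists D.
  move/(card_le_injP 0%N): DDc => [f finj].
  have /choice[e eP] : forall n, exists D, DD D /\
      (forall D', DD D' -> f D' = n -> D = D').
    move=> n; have [[D [DDD fD]]|nD] := pselect (exists D, DD D /\ f D = n).
      by exists D; split=> // D' DDD' fD'; apply: finj => //; rewrite fD.
    by exists D0; split=> // D DDD fD; case: nD; exists D.
  exists e; split=> [n|D DDD]; first exact: DDdense (eP n).1.
  by exists (f D) => //; exact: (eP _).2.
case: eDD => edense DDe.
have /choice[s sP] : forall np : nat * P, exists q, e np.1 q /\ (q <= np.2)%O.
  by move=> [n p]; exact: edense.
pose u := fix u n := if n is m.+1 then s (m, u m) else p0.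
have uS n : (u n.+1 <= u n)%O by exact: (sP (n, u n)).2.
have u_le m n : (m <= n)%N -> (u n <= u m)%O.
  move=> mn; rewrite -(subnK mn); elim: (n - m)%N => [//|k IH].
  by rewrite addSn; exact: Order.POrderTheory.le_trans (uS _) IH.
exists [set p | exists n, (u n <= p)%O]; split; first split.
- by exists p0; exists 0%N => /=.
- move=> p q [n np] pq; exists n; exact: Order.POrderTheory.le_trans np pq.
- move=> p q [n np] [m mq]; exists (u (maxn m n)); split.
  + by exists (maxn m n).
  + by apply: Order.POrderTheory.le_trans np; apply: u_le; exact: leq_maxr.
  + by apply: Order.POrderTheory.le_trans mq; apply: u_le; exact: leq_maxl.
- move=> D /DDe[n _ <-]; exists (u n.+1); split; first by exists n.+1.
  exact: (sP (n, u n)).1.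
Qed.

(** Conditions of the forcing that adds a pseudo-intersection of the family
    [C]: a finite approximation of the generic set, and a finite set of
    promises, each being a set that has to contain all elements added later.
    Promises outside of [C] have no effect, so that no restriction has to be
    put on them. *)
Definition cond (C : set (set nat)) : Type :=
  ({fset nat} * {fset (set nat)})%type.

HB.instance Definition _ C :=
  Choice.copy (cond C) ({fset nat} * {fset (set nat)})%type.

(** [cond_le q p] says that the condition [q] is stronger than [p]. *)
Definition cond_le C : rel (cond C) := fun q p =>
  `[< [/\ (p.1 `<=` q.1)%fset, (p.2 `<=` q.2)%fset &
      forall n c, n \in q.1 -> n \notin p.1 -> c \in p.2 -> C c -> c n] >].

Lemma cond_le_refl C : reflexive (@cond_le C).
Proof.
by move=> p; apply/asboolP; split=> // n c ->.
Qed.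

Lemma cond_le_anti C : antisymmetric (@cond_le C).
Proof.
move=> [s F] [t G] /andP[/asboolP[/= st FG _] /asboolP[/= ts GF _]].
by congr pair; apply/eqP; rewrite eqEfsubset ?st ?ts ?FG ?GF.
Qed.

Lemma cond_le_trans C : transitive (@cond_le C).
Proof.
move=> q p r /asboolP[s1 F1 H1] /asboolP[s2 F2 H2]; apply/asboolP; split.
- exact: fsubset_trans s2 s1.
- exact: fsubset_trans F2 F1.
- move=> n c np nr cr Cc; have [nq|nq] := boolP (n \in q.1).
    exact: H2 nq _ _ _.
  by apply: H1 np nq _ _ => //; exact: (fsubsetP F2).
Qed.

HB.instance Definition _ C := Order.Le_isPOrder.Build
  (Order.Disp tt tt) (cond C)
  (@cond_le_refl C) (@cond_le_anti C) (@cond_le_trans C).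

(** Conditions with the same first component are compatible. *)
Lemma cond_ccc C : ccc (cond C).
Proof.
move=> A Aanti; apply/(card_le_injP 0%N).
exists (fun p => choice.pickle p.1) => -[s F] [t G] Ap Aq.
move=> /(pcan_inj choice.pickleK) /= st.
apply: contrapT => pq; apply: (Aanti _ _ Ap Aq pq).
rewrite -{}st in Aq pq *; exists (s, F `|` G)%fset.
split; apply/asboolP; split=> //=; rewrite ?fsubsetUl ?fsubsetUr //.
  by move=> n c ->.
by move=> n c ->.
Qed.

Lemma infinite_natP (S : set nat) :
  infinite_set S <-> forall m, exists2 n, (m <= n)%N & S n.
Proof.
split=> [Sinf m|Sunb].
  apply: contrapT => Sm; apply: Sinf.
  apply: sub_finite_set (finite_II m) => n Sn /=.
  by rewrite ltnNge; apply/negP => mn; apply: Sm; exists n.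
move=> /finite_fsetP[X SX].
have [n] := Sunb (\max_(i <- X) i).+1; rewrite SX /= => + nX.
by rewrite ltnNge => /negP; apply; exact: leq_bigmax_seq.
Qed.

(** If every finite intersection of members of [C] meets every member of [B] in
    an infinite set, then so does some pseudo-intersection of [C]. *)
Lemma pseudo_intersection (K : Type) (Kinf : infinite_set [set: K]) (MAK : MA K)
    (C B : set (set nat)) :
  C #<= [set: K] -> B #<= [set: K] ->
  (forall F b, finite_set F -> F `<=` C -> B b ->
     infinite_set (\bigcap_(c in F) c `&` b)) ->
  exists X : set nat, (forall c, C c -> finite_set (X `\` c)) /\
                      (forall b, B b -> infinite_set (X `&` b)).
Proof.
move=> CK BK CB.
pose DC c : set (cond C) := [set p | c \in p.2].
pose DB b m : set (cond C) :=
  [set p | exists n, [/\ (m <= n)%N, n \in p.1 & b n]].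
pose DD := (DC @` C) `|` \bigcup_(b in B) range (DB b).
have DDK : DD #<= [set: K].
  apply: (card_leU Kinf); first exact: card_le_trans (card_image_le _ _) CK.
  apply: (card_le_bigcup Kinf) => // b _; apply: (countable_card_le Kinf).
  exact: card_image_le.
have [||G [[Gne Gup Gdir] Gmeet]] := MAK _ (cond C) _ (@cond_ccc C) DD DDK.
- by exists (fset0, fset0).
- move=> _ [[c Cc <-]|[b Bb [m _ <-]]] [s F].
    exists (s, c |` F)%fset; split; first exact: fset1U1.
    by apply/asboolP; split=> //=; [exact: fsubsetU1|move=> n d ->].
  have Ffin : finite_set [set c | c \in F /\ C c].
    by apply: sub_finite_set (finite_fset F) => c [].
  have FC : [set c | c \in F /\ C c] `<=` C by move=> c [].
  have /infinite_natP/(_ m)[n mn [nF bn]] := CB _ b Ffin FC Bb.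
  exists (n |` s, F)%fset; split; first by exists n; split=> //; exact: fset1U1.
  apply/asboolP; split=> //=; first exact: fsubsetU1.
  by move=> k c; rewrite !inE => /orP[/eqP->|->//] _ cF Cc; exact: nF.
exists [set n | exists2 p, G p & n \in p.1]; split=> [c Cc|b Bb].
  have [|p [Gp cp]] := Gmeet (DC c); first by left; exists c.
  apply: sub_finite_set (finite_fset p.1) => n [[q Gq nq] nc] /=.
  have [r [Gr /asboolP[_ _ rp] /asboolP[rq _ _]]] := Gdir _ _ Gp Gq.
  apply: contrapT => /negP np; apply: nc; apply: (rp n) => //.
  exact: (fsubsetP rq).
apply/infinite_natP => m.
have [|p [Gp [n [mn np bn]]]] := Gmeet (DB b m); first by right; exists b.
by exists n => //; split=> //; exists p.
Qed.

(** * Positive sets *)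

(** The members of [A] having an infinite intersection with [X]. *)
Definition trace (A : set (set nat)) (X : set nat) : set (set nat) :=
  [set a | A a /\ infinite_set (X `&` a)].

(** For a mad family [A] the positive sets are those which are not almost
    covered by finitely many members of [A]. *)
Definition positive (A : set (set nat)) (X : set nat) : Prop :=
  infinite_set (trace A X).

(** All finite intersections of members of [C] are positive; for the empty
    intersection this includes that the set of all numbers is. *)
Definition centered (A C : set (set nat)) : Prop :=
  forall F, finite_set F -> F `<=` C -> positive A (\bigcap_(c in F) c).

Lemma trace_sub A X Y : finite_set (X `\` Y) -> trace A X `<=` trace A Y.
Proof.
move=> XY a [Aa Xa]; split=> // Ya; apply: Xa.
apply: (@sub_finite_set _ _ ((X `\` Y) `|` (Y `&` a))).
  move=> n [Xn an]; have [Yn|nY] := pselect (Y n); [by right|by left].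
by rewrite finite_setU.
Qed.

Lemma positive_sub A X Y : finite_set (X `\` Y) -> positive A X -> positive A Y.
Proof. by move=> /(@trace_sub A)/sub_infinite_set; apply. Qed.

Lemma positive_subset A X Y : X `<=` Y -> positive A X -> positive A Y.
Proof.
by move=> XY; apply: positive_sub; rewrite (_ : X `\` Y = set0) // setD_eq0.
Qed.

Lemma positive_infinite A X : positive A X -> infinite_set X.
Proof.
move=> /infinite_setN0[a [_ Xa]]; apply: sub_infinite_set Xa.
exact: subIsetl.
Qed.

Lemma positiveU A X Y : positive A (X `|` Y) -> positive A X \/ positive A Y.
Proof.
move=> XY; apply: contrapT => /not_orP[/contrapT Xfin /contrapT Yfin].
apply: XY; apply: (@sub_finite_set _ _ (trace A X `|` trace A Y)).
  move=> a [Aa]; rewrite setIUl finite_setU => /not_andP[Xa|Ya].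
    by left.
  by right.
by rewrite finite_setU.
Qed.

Lemma finite_setD_bigcap (F : set (set nat)) X :
  finite_set F -> (forall c, F c -> finite_set (X `\` c)) ->
  finite_set (X `\` \bigcap_(c in F) c).
Proof.
move=> Ffin XF; apply: sub_finite_set (bigcup_finite Ffin XF) => n [Xn nF].
apply: contrapT => Xc; apply: nF => c Fc.
by apply: contrapT => nc; apply: Xc; exists c.
Qed.

Lemma mad_meet A X : mad_family A -> infinite_set X ->
  exists2 a, A a & infinite_set (X `&` a).
Proof.
move=> [[Ainf Aad] Amax] Xinf; apply: contrapT => nX.
have Xfin a : A a -> finite_set (X `&` a).
  by move=> Aa; apply: contrapT => Xa; apply: nX; exists a.
apply: Amax; exists (X |` A); split; [split|split].
- by move=> a [->|/Ainf].
- move=> a b [->|Aa] [->|Ab]; [by left|by right; exact: Xfin| |exact: Aad].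
  by right; rewrite setIC; exact: Xfin.
- by move=> a Aa; right.
- move=> /(_ X (or_introl erefl)) AX; apply: nX; exists X => //.
  by rewrite setIid.
Qed.

(** Removing finitely many members of [A] different from [a] does not affect
    whether the intersection with [a] is infinite. *)
Lemma infinite_setDI A (a : set nat) (G : set (set nat)) Y :
  almost_disjoint_family A -> A a -> finite_set G -> G `<=` A -> ~ G a ->
  infinite_set (Y `&` a) -> infinite_set ((Y `\` \bigcup_(b in G) b) `&` a).
Proof.
move=> [_ Aad] Aa Gfin GA Ga Ya fin; apply: Ya.
apply: (@sub_finite_set _ _
  ((Y `\` \bigcup_(b in G) b) `&` a `|` \bigcup_(b in G) (a `&` b))).
  move=> n [Yn an]; have [[b Gb bn]|nG] := pselect ((\bigcup_(b in G) b) n).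
    by right; exists b.
  by left.
rewrite finite_setU; split=> //; apply: bigcup_finite => // b Gb.
by have [ab|//] := Aad _ _ Aa (GA _ Gb); case: Ga; rewrite ab.
Qed.

Lemma positive_setD_bigcup A X (G : set (set nat)) :
  almost_disjoint_family A -> finite_set G -> G `<=` A ->
  positive A X -> positive A (X `\` \bigcup_(b in G) b).
Proof.
move=> Aad Gfin GA Xpos fin; apply: Xpos.
apply: (@sub_finite_set _ _ (trace A (X `\` \bigcup_(b in G) b) `|` G)).
  move=> a [Aa Xa]; have [Ga|nGa] := pselect (G a); [by right|left; split=> //].
  exact: (infinite_setDI Aad Aa Gfin GA nGa Xa).
by rewrite finite_setU.
Qed.

(** For a mad family the pseudo-intersection of a centered family can be taken
    to be positive.  The point is that infinitely many members of [A] meet all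
    finite intersections of [C] in an infinite set: if there were only finitely
    many, a pseudo-intersection of [C] avoiding them would have a finite
    intersection with all members of [A]. *)
Lemma positive_pseudo_intersection (K : Type) (Kinf : infinite_set [set: K])
    (MAK : MA K) (A C : set (set nat)) :
  mad_family A -> C #<= [set: K] -> centered A C ->
  exists2 X, positive A X & forall c, C c -> finite_set (X `\` c).
Proof.
move=> Amad CK Ccent; have Aad := Amad.1.
pose G := [set a | A a /\ forall F, finite_set F -> F `<=` C ->
  infinite_set (\bigcap_(c in F) c `&` a)].
have Ginf : infinite_set G.
  move=> Gfin; have GA : G `<=` A by move=> a [].
  pose U := ~` \bigcup_(b in G) b.
  have [|||X [XC XT]] := @pseudo_intersection _ Kinf MAK (U |` C) [set setT].
  - by apply: (card_leU Kinf) => //; apply: (countable_card_le Kinf);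
      exact: finite_set_countable.
  - by apply: (countable_card_le Kinf); exact: finite_set_countable.
  - move=> F _ Ffin FC ->; rewrite setIT.
    have Fpos := Ccent _ (finite_setIl C Ffin) (@subIsetr _ _ _).
    apply: (@positive_infinite A).
    apply: positive_subset (positive_setD_bigcup Aad Gfin GA Fpos).
    by move=> n [Fn Un] c Fc; have [->//|Cc] := FC _ Fc; exact: Fn.
  have [|a Aa Xa] := @mad_meet A X Amad.
    by have := XT _ erefl; rewrite setIT.
  have Ga : G a.
    split=> // F Ffin FC fin; apply: Xa.
    apply: (@sub_finite_set _ _
      ((X `\` \bigcap_(c in F) c) `|` (\bigcap_(c in F) c `&` a))).
      move=> n [Xn an]; have [Fn|nF] := pselect ((\bigcap_(c in F) c) n).
        by right.
      by left.
    rewrite finite_setU; split=> //; apply: finite_setD_bigcap => // c Fc.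
    by apply: XC; right; exact: FC.
  apply: Xa; apply: sub_finite_set (XC U (or_introl erefl)) => n [Xn an].
  by split=> //; apply; exists a.
have /infiniteP/pcard_leP[g] := Ginf.
have [||X [XC XG]] := @pseudo_intersection _ Kinf MAK C (range g) CK.
- by apply: (countable_card_le Kinf); exact: card_image_le.
- move=> F _ Ffin FC [n _ <-]; have [_] := 'funS_g (I : setT n).
  exact.
exists X => //; apply: (@sub_infinite_set _ (range g)).
  move=> _ [n _ <-]; have [An _] := 'funS_g (I : setT n).
  by split=> //; apply: XG; exists n.
apply/infiniteP.
by have/card_eqPle[] := inj_card_eq 'inj_g.
Qed.

(** * Kernels of trees *)

(** The set of natural numbers coded by the branch [z], where [c] gives the
    value of the characteristic function that a letter stands for. *)
Definition real (L : Type) (c : L -> bool) (z : nat -> L) : set nat :=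
  [set n | c (z n)].

(** The branches of [S] passing through the node [t]. *)
Definition through (L : Type) (S : set (seq L)) (t : seq L) : set (nat -> L) :=
  [set z | branches S z /\ mkseq z (size t) = t].

(** The union of the sets coded by the branches of [S] through [t]. *)
Definition shadow (L : Type) (c : L -> bool) (S : set (seq L)) (t : seq L) :
    set nat :=
  \bigcup_(z in through S t) real c z.

(** The largest subtree of [T] all of whose nodes have a shadow, computed in
    the subtree itself, with a positive intersection with [X]; it is the union
    of all such subtrees. *)
Definition kernel (A : set (set nat)) (L : Type) (c : L -> bool)
    (T : set (seq L)) (X : set nat) : set (seq L) :=
  [set t | exists S, [/\ is_tree S, S `<=` T, S t &
     forall r, S r -> positive A (X `&` shadow c S r)]].

Lemma shadow_subset (L : Type) (c : L -> bool) (S S' : set (seq L)) t :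
  S `<=` S' -> shadow c S t `<=` shadow c S' t.
Proof.
by move=> SS' n [z [Sz zt] zn]; exists z => //; split=> // m; exact: SS'.
Qed.

Section Kernel.
Context (A : set (set nat)) (L : Type) (c : L -> bool) (T : set (seq L)).
Local Notation kernel := (kernel A c T).

Lemma kernel_tree X : is_tree (kernel X).
Proof.
move=> s t [S [Stree ST Sst Spos]]; exists S; split=> //; exact: Stree Sst.
Qed.

Lemma kernel_subset X : kernel X `<=` T.
Proof. by move=> t [S [_ ST St _]]; exact: ST. Qed.

Lemma kernel_positive X t : kernel X t ->
  positive A (X `&` shadow c (kernel X) t).
Proof.
move=> [S [Stree ST St Spos]]; apply: positive_subset (Spos _ St).
by apply: setIS; apply: shadow_subset => r Sr; exists S.
Qed.

Lemma kernel_sub X Y : finite_set (X `\` Y) -> kernel X `<=` kernel Y.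
Proof.
move=> XY t [S [Stree ST St Spos]]; exists S; split=> // r Sr.
apply: positive_sub (Spos _ Sr).
by apply: sub_finite_set XY => n [[Xn Sn] nYS]; split=> // Yn; exact: nYS.
Qed.

Lemma not_kernel X (S : set (seq L)) : is_tree S -> S `<=` T ->
  S !=set0 -> ~ kernel X [::] ->
  exists2 r, S r & ~ positive A (X `&` shadow c S r).
Proof.
move=> Stree ST [t St] nX; apply: contrapT => nr; apply: nX.
exists S; split=> //; first exact: (Stree [::] t).
by move=> r Sr; apply: contrapT => Sr0; apply: nr; exists r.
Qed.

End Kernel.

Lemma finite_sub_chain (T : Type) (U : choiceType) (g : T -> U)
    (FF : set (set T)) (F : set U) :
  FF !=set0 -> total_on FF subset -> finite_set F ->
  F `<=` g @` (\bigcup_(G in FF) G) -> exists2 G, FF G & F `<=` g @` G.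
Proof.
move=> [G0 FG0] totFF /finite_fsetP[X ->] sub.
suff [G FG XG] : exists2 G, FF G & forall x, x \in (X : seq U) -> (g @` G) x.
  by exists G => // x; exact: XG.
have {sub} : forall x, x \in (X : seq U) -> (g @` (\bigcup_(G in FF) G)) x.
  by move=> x; exact: sub.
elim: (X : seq U) => [|x s IH] sub; first by exists G0.
have [y ys|G FG sG] := IH; first by apply: sub; rewrite inE ys orbT.
have [y [H FH Hy] gy] := sub _ (mem_head x s).
have [GH|HG] := totFF _ _ FG FH.
  exists H => // w; rewrite inE => /orP[/eqP->|/sG]; first by exists y.
  exact: image_subset.
exists G => // w; rewrite inE => /orP[/eqP->|/sG//].
by exists y => //; exact: HG.
Qed.

(** Some positive [X] has the same kernel as all its positive subsets.  By
    Zorn's lemma there is a maximal way [Phi] of assigning to some of the nodes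
    sets whose kernel does not contain them, such that the assigned sets are
    centered.  A positive pseudo-intersection [X] of these sets works: if a
    positive subset of [X] had a kernel missing a node of the kernel of [X],
    it could be assigned to this node. *)
Lemma stable_kernel (K : Type) (Kinf : infinite_set [set: K]) (MAK : MA K)
    (A : set (set nat)) (L : Type) (c : L -> bool) (T : set (seq L)) :
  [set: seq L] #<= [set: K] -> infinite_set A -> mad_family A ->
  exists2 X, positive A X &
    forall Y, Y `<=` X -> positive A Y -> kernel A c T Y = kernel A c T X.
Proof.
move=> LK Ainf Amad.
have posT : positive A setT.
  apply: sub_infinite_set Ainf => a Aa; split=> //.
  by rewrite setTI; exact: Amad.1.1.
pose P (Phi : set (seq L * set nat)) := [/\
  forall t Y Y', Phi (t, Y) -> Phi (t, Y') -> Y = Y',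
  forall t Y, Phi (t, Y) -> ~ kernel A c T Y t &
  centered A (snd @` Phi)].
have [FF FP totFF|Phi [[Phifun Phiker Phicent] Phimax]] := @Zorn_bigcup _ P.
  have [FF0|FF0] := pselect (FF !=set0); last first.
    have -> : \bigcup_(G in FF) G = set0.
      by rewrite -subset0 => x [G FG]; case: FF0; exists G.
    split=> // F Ffin; rewrite image_set0 subset0 => ->.
    by rewrite bigcap_set0.
  split.
  - move=> t Y Y' [G FG GY] [H FH HY'].
    have [GH|HG] := totFF _ _ FG FH.
      by have [Hf _ _] := FP _ FH; apply: (Hf t) => //; exact: GH.
    by have [Gf _ _] := FP _ FG; apply: (Gf t) => //; exact: HG.
  - by move=> t Y [G FG GY]; have [_ Gk _] := FP _ FG; exact: Gk.
  - move=> F Ffin /(finite_sub_chain FF0 totFF Ffin)[G FG sub].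
    by have [_ _ Gc] := FP _ FG; exact: Gc.
have CK : snd @` Phi #<= [set: K].
  have -> : snd @` Phi = \bigcup_(t in setT) [set Y | Phi (t, Y)].
    rewrite predeqE => Y; split=> [[[t Y'] PY <-]|[t _ PY]]; first by exists t.
    by exists (t, Y).
  apply: (card_le_bigcup Kinf) => // t _; apply: (countable_card_le Kinf).
  have [[Y PY]|nY] := pselect (exists Y, Phi (t, Y)).
    apply/finite_set_countable/(sub_finite_set _ (finite_set1 Y)) => Z PZ.
    exact: Phifun PZ PY.
  rewrite (_ : [set Y | Phi (t, Y)] = set0) ?countable0 // -subset0 => Y PY.
  by apply: nY; exists Y.
have [X Xpos XC] := positive_pseudo_intersection Kinf MAK Amad CK Phicent.
exists X => // Y YX Ypos; rewrite eqEsubset; split.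
  by apply: kernel_sub; rewrite (_ : Y `\` X = set0) // setD_eq0.
move=> t Xt; apply: contrapT => Yt.
have tPhi Z : ~ Phi (t, Z).
  move=> PZ; apply: (Phiker _ _ PZ); apply: kernel_sub Xt.
  by apply: XC; exists (t, Z).
apply: (Phimax (Phi `|` [set (t, Y)])).
  split=> [p Pp|/(_ (t, Y) (or_intror erefl))]; first by left.
  exact: tPhi.
split.
- move=> s Z Z' [PZ|[? ?]] [PZ'|[? ?]]; subst => //.
  + exact: Phifun PZ PZ'.
  + by case: (tPhi _ PZ).
  + by case: (tPhi _ PZ').
- by move=> s Z [/Phiker//|[-> ->]].
- move=> F Ffin FPhi; apply: positive_sub Ypos.
  apply: finite_setD_bigcap => // Z /FPhi[[s Z'] [PZ|[_ ->]] <-] /=.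
    have ZX : finite_set (X `\` Z') by apply: XC; exists (s, Z').
    by apply: sub_finite_set ZX => n [/YX Xn nZ].
  by rewrite setDv.
Qed.

(** * Building branches *)

Lemma mkseqD (L : Type) (z : nat -> L) m n :
  mkseq z (m + n) = mkseq z m ++ mkseq (fun i => z (m + i)%N) n.
Proof.
by rewrite /mkseq iotaD map_cat add0n -[X in iota X n]addn0 iotaDl -map_comp.
Qed.

Lemma mkseq_prefix (L : Type) (z : nat -> L) m n : (m <= n)%N ->
  exists r, mkseq z n = mkseq z m ++ r.
Proof. by move=> mn; rewrite -(subnKC mn) mkseqD; eexists. Qed.

Lemma mkseq_eq_nth (L : Type) (z w : nat -> L) m n : (n < m)%N ->
  mkseq z m = mkseq w m -> z n = w n.
Proof. by move=> nm /(congr1 (fun s => nth (z n) s n)); rewrite !nth_mkseq. Qed.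

(** The nodes of an increasing sequence whose lengths are unbounded lie on a
    common branch. *)
Lemma limit_branch (L : Type) (S : set (seq L)) (u : nat -> seq L) :
  is_tree S -> (forall k, S (u k)) -> (forall k, (k <= size (u k))%N) ->
  (forall k, exists r, u k.+1 = u k ++ r) ->
  exists2 z, branches S z & forall k, mkseq z (size (u k)) = u k.
Proof.
move=> Stree Su usize uS.
have [x0 _] : exists x0 : L, True.
  by have := usize 1%N; case: (u 1%N) => // x0 s _; exists x0.
have u_le m n : (m <= n)%N -> exists r, u n = u m ++ r.
  move=> mn; rewrite -(subnK mn); elim: (n - m)%N => [|k [r IH]].
    by exists [::]; rewrite cats0.
  by rewrite addSn; have [s ->] := uS (k + m)%N; rewrite IH -catA; eexists.
pose z i := nth x0 (u i.+1) i.
have zu k : mkseq z (size (u k)) = u k.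
  apply: (@eq_from_nth _ x0); first by rewrite size_mkseq.
  rewrite size_mkseq => i ik; rewrite nth_mkseq // /z.
  have [ki|ki] := leqP k i.+1.
    by have [r ->] := u_le _ _ ki; rewrite nth_cat ik.
  by have [r ->] := u_le _ _ (ltnW ki); rewrite nth_cat usize.
exists z => // n; have [r zr] := mkseq_prefix z (usize n).
by apply: (Stree _ r); rewrite -zr zu.
Qed.

(** If the shadows of any two nodes of [S] have an infinite intersection, then
    through any two nodes there are branches coding sets with an infinite
    intersection: alternately pick a large number in both shadows and lengthen
    the two nodes along branches whose sets contain it. *)
Lemma infinite_common_part (L : Type) (c : L -> bool) (S : set (seq L)) :
  is_tree S ->
  (forall t t', S t -> S t' -> infinite_set (shadow c S t `&` shadow c S t')) ->
  forall t t', S t -> S t' -> exists z z', [/\ through S t z, through S t' z' &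
    infinite_set (real c z `&` real c z')].
Proof.
move=> Stree Sinf t t' St St'.
have /choice[s sP] : forall p : (seq L * seq L) * nat, exists q : seq L * seq L,
    S p.1.1 -> S p.1.2 -> [/\ S q.1 /\ S q.2,
      (exists r, q.1 = p.1.1 ++ r) /\ (exists r, q.2 = p.1.2 ++ r),
      (p.2 < size q.1)%N /\ (p.2 < size q.2)%N &
      exists2 n, (p.2 <= n)%N & forall z z', mkseq z (size q.1) = q.1 ->
        mkseq z' (size q.2) = q.2 -> c (z n) /\ c (z' n)].
  move=> [[v v'] m] /=.
  have [Sv|] := pselect (S v); last by exists (v, v').
  have [Sv'|] := pselect (S v'); last by exists (v, v').
  have /infinite_natP/(_ m)[n mn [nv nv']] := Sinf _ _ Sv Sv'.
  have [w [Sw wv] wn] := nv; have [w' [Sw' wv'] wn'] := nv'.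
  pose N := (size v + size v' + n.+1)%N.
  have nN : (n < N)%N by rewrite /N addnS ltnS leq_addl.
  exists (mkseq w N, mkseq w' N) => _ _ /=; rewrite !size_mkseq; split.
  - by split; [exact: Sw|exact: Sw'].
  - split.
      by rewrite -wv; apply: mkseq_prefix; rewrite /N -addnA leq_addr.
    by rewrite -wv'; apply: mkseq_prefix; rewrite /N addnAC leq_addl.
  - by split; exact: leq_ltn_trans mn nN.
  - exists n => // z z' /(mkseq_eq_nth nN)-> /(mkseq_eq_nth nN)->.
    by split.
pose u := fix u k := if k is j.+1 then s (u j, j) else (t, t').
have Su k : S (u k).1 /\ S (u k).2.
  by elim: k => [//|k [S1 S2]]; have [] := sP (u k, k) S1 S2.
have uP k := sP (u k, k) (Su k).1 (Su k).2.
have [z Sz zu] : exists2 z, branches S z &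
    forall k, mkseq z (size (u k).1) = (u k).1.
  apply: (limit_branch (u := fun k => (u k).1)) => // [k|[|k]|k].
  - exact: (Su k).1.
  - by [].
  - by have [_ _ []] := uP k.
  - by have [_ []] := uP k.
have [z' Sz' zu'] : exists2 z, branches S z &
    forall k, mkseq z (size (u k).2) = (u k).2.
  apply: (limit_branch (u := fun k => (u k).2)) => // [k|[|k]|k].
  - exact: (Su k).2.
  - by [].
  - by have [_ _ []] := uP k.
  - by have [_ []] := uP k.
exists z, z'; split.
- by split; last exact: zu 0%N.
- by split; last exact: zu' 0%N.
- apply/infinite_natP => m; have [_ _ _ [n mn nP]] := uP m.
  by exists n => //; exact: nP (zu m.+1) (zu' m.+1).
Qed.

(** * Projections of trees are not mad *)

Lemma no_mad_projection (K : Type) (Kinf : infinite_set [set: K]) (MAK : MA K)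
    (A : set (set nat)) (L : Type) (c : L -> bool) (T : set (seq L)) :
  [set: seq L] #<= [set: K] -> infinite_set A -> mad_family A ->
  is_tree T -> A = real c @` branches T -> False.
Proof.
move=> LK Ainf Amad Ttree AT; have Aad := Amad.1.
have [X Xpos Xstable] := stable_kernel Kinf MAK c T LK Ainf Amad.
set S := kernel A c T X in Xstable.
have Stree : is_tree S by exact: kernel_tree.
have [S0|S0] := pselect (S [::]).
  have Sdiff t : S t -> ~ positive A (X `\` shadow c S t).
    move=> St pos; have E := Xstable _ (@subDsetl _ _ _) pos.
    move: (St); rewrite -E => /kernel_positive; rewrite E.
    move=> /positive_infinite; apply; rewrite (_ : _ `&` _ = set0) //.
    by rewrite -subset0 => n [[]].
  have Sinf t t' : S t -> S t' -> infinite_set (shadow c S t `&` shadow c S t').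
    move=> St St'; apply: (@positive_infinite A).
    have : positive A ((X `\` shadow c S t) `|`
        ((X `\` shadow c S t') `|` (shadow c S t `&` shadow c S t'))).
      apply: positive_subset Xpos => n Xn.
      have [tn|tn] := pselect (shadow c S t n); last by left.
      have [t'n|t'n] := pselect (shadow c S t' n); last by right; left.
      by right; right.
    by move=> /positiveU[/(Sdiff _ St)//|/positiveU[/(Sdiff _ St')//|]].
  (* If all branches of [S] coded the same member of [A], the shadow of the
     root would be this member, which is not positive. *)
  have [z [z' [Sz Sz' zz']]] : exists z z', [/\ branches S z, branches S z' &
      real c z <> real c z'].
    apply: contrapT => nz.
    have [n [[z [Sz _] _] _]] := infinite_setN0 (Sinf _ _ S0 S0).
    have Az : A (real c z).
      by rewrite AT; exists z => // m; exact: kernel_subset (Sz m).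
    apply: (kernel_positive S0).
    apply: (sub_finite_set _ (finite_set1 (real c z))).
    move=> a [Aa Xa]; have [//|fin] := Aad.2 _ _ Az Aa.
    case: Xa; apply: sub_finite_set fin => k [[_ [w [Sw _] wk]] ak].
    split=> //; suff -> : real c z = real c w by [].
    by apply: contrapT => zw; apply: nz; exists z, w.
  have [n zn] : exists n, c (z n) <> c (z' n).
    apply: contrapT => /forallNP zzE; apply: zz'; rewrite predeqE => n.
    by rewrite /real /= (contrapT (zzE n)).
  have [w [w' [[Sw wz] [Sw' wz'] ww']]] :=
    infinite_common_part Stree Sinf (Sz n.+1) (Sz' n.+1).
  rewrite !size_mkseq in wz wz'.
  have Aw v : branches S v -> A (real c v).
    by move=> Sv; rewrite AT; exists v => // m; exact: kernel_subset (Sv m).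
  have [ww|//] := Aad.2 _ _ (Aw _ Sw) (Aw _ Sw').
  apply: zn; rewrite -(mkseq_eq_nth (ltnSn n) wz) -(mkseq_eq_nth (ltnSn n) wz').
  have : (real c w n) = (real c w' n) by rewrite ww.
  by rewrite /real /= => /is_true_inj.
(* [B t] consists of the members of [A] coded by a branch through [t] and
   having an infinite intersection with [X]. *)
pose B t := (real c @` through T t) `&` trace A X.
have [small|large] := pselect (B [::] #<= [set: K]).
  have trX : trace A X = B [::].
    rewrite /B setIidr // => a [Aa _]; move: Aa; rewrite AT => -[z Tz <-].
    by exists z.
  pose C := (fun a => X `\` a) @` trace A X.
  have CK : C #<= [set: K].
    by rewrite /C trX; exact: card_le_trans (card_image_le _ _) small.
  have Ccent : centered A C.
    move=> F Ffin FC.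
    have [G [Gfin GX GF]] : exists G, [/\ finite_set G, G `<=` trace A X &
        X `\` \bigcup_(b in G) b `<=` \bigcap_(c in F) c].
      have /choice[g gP] : forall Y, exists a,
          F Y -> trace A X a /\ X `\` a = Y.
        move=> Y; have [/FC[a Xa XaY]|] := pselect (F Y); first by exists a.
        by exists setT.
      exists (g @` F); split; first exact: finite_image.
        by move=> _ [Y FY <-]; exact: (gP _ FY).1.
      move=> n [Xn nG] Y FY; rewrite -(gP _ FY).2; split=> // gn.
      by apply: nG; exists (g Y) => //; exists Y.
    apply: positive_subset GF _; apply: positive_setD_bigcup => //.
    by move=> a /GX[].
  have [Y Ypos YC] := positive_pseudo_intersection Kinf MAK Amad CK Ccent.
  have Xdiff a : trace A X a -> finite_set (Y `\` (X `\` a)).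
    by move=> Xa; apply: YC; exists a.
  have YX : finite_set (Y `\` X).
    have [a Xa] := infinite_setN0 Xpos.
    by apply: sub_finite_set (Xdiff a Xa) => n [Yn nX]; split=> // -[].
  have [a Ya] := infinite_setN0 Ypos; apply: Ya.2.
  apply: sub_finite_set (Xdiff a (trace_sub YX Ya)) => n [Yn an].
  by split=> // -[].
pose S' := [set t | T t /\ ~ (B t #<= [set: K])].
have S'tree : is_tree S'.
  move=> s t [Tst Bst]; split; first exact: Ttree Tst.
  apply: contra_not Bst => Bs; apply: card_le_trans Bs; apply: subset_card_le.
  apply: setSI => _ [z [Tz zst] <-]; exists z => //; split=> //.
  move: zst => /(congr1 (take (size s))).
  by rewrite size_cat mkseqD !take_size_cat ?size_mkseq.
have S'0 : S' !=set0.
  exists [::]; split=> //.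
  have [a Aa] := infinite_setN0 Ainf; move: Aa; rewrite AT => -[z Tz _].
  exact: Tz 0%N.
have [r [Tr Br] nr] := not_kernel S'tree (fun t => @proj1 _ _) S'0 S0.
apply: Br; apply: (@card_le_trans _ _ _ (trace A (X `&` shadow c S' r) `|`
   \bigcup_(q in T `\` S') B q)).
  apply: subset_card_le => _ [[z [Tz zr] <-] [Az Xz]].
  have [S'z|/existsNP[n S'z]] := pselect (branches S' z); last first.
    right; exists (mkseq z n); first by split.
    split; last by split.
    by exists z => //; split=> //; rewrite size_mkseq.
  left; split=> //; apply: sub_infinite_set Xz => n [Xn zn].
  by split=> //; split=> //; exists z.
apply: (card_leU Kinf).
  by apply/(countable_card_le Kinf)/finite_set_countable; exact: contrapT.
apply: (card_le_bigcup Kinf) => [|q [Tq nS']].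
  by apply: card_le_trans LK; exact: card_leT.
by apply: contrapT => nB; apply: nS'.
Qed.

Lemma real_fst_branches (K : Type) (A : set (set nat))
    (T : set (seq (bool * K))) :
  char_fun @` A = tree_projection T -> A = real fst @` branches T.
Proof.
move=> AT; rewrite predeqE => a; split=> [Aa|[z Tz <-]].
  have [y Ty] : tree_projection T (char_fun a) by rewrite -AT; exists a.
  exists (fun n => (char_fun a n, y n)) => //.
  by rewrite predeqE => n; split=> [/set_mem|/mem_set].
have [b Ab bz] : (char_fun @` A) (fst \o z).
  rewrite AT; exists (snd \o z).
  rewrite (_ : (fun n => _) = z) //; apply/funext => n /=.
  by rewrite -surjective_pairing.
rewrite (_ : real fst z = b) // predeqE => n.
rewrite /real /= -[(z n).1]/((fst \o z) n) -bz.
by split=> [/set_mem|/mem_set].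
Qed.

Theorem theorem1p2 (K : Type) (K_lt_continuum : card_lt K (nat -> bool))
    (MA_K : MA K) :
  ~ (exists A : set (set nat),
       [/\ infinite_set A, Souslin K A & mad_family A]).
Proof.
have [K' [K'inf MAK' KK']] : exists K', [/\ infinite_set [set: K'], MA K' &
    [set: K] #<= [set: K']].
  have [Kfin|Kinf] := pselect (finite_set [set: K]); last by exists K.
  exists nat; split; [exact: infinite_nat|exact: MA_nat|].
  exact: finite_set_countable.
move=> [A [Ainf [T [Ttree AT]] Amad]].
exact: (no_mad_projection K'inf MAK' (card_le_seq_pair K'inf KK') Ainf Amad
  Ttree (real_fst_branches AT)).
Qed.
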